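(* Let $T\ge 2$ be an integer and let $\mu>0$, $\sigma>0$, $-\frac{1}{T-1}<\rho<1$ satisfy $\mu^2+\rho\sigma^2>0$. Let $$\mathrm{L}(\gamma)=\sup_{\mathbb P\in\mathcal P}\mathbb P\Big(\prod_{t=1}^T\tilde\xi_t\le\gamma\Big),$$ with the ambiguity set $\mathcal P$ defined in the context. If $T>\frac{\mu^2+\sigma^2}{(1-\rho)\sigma^2}+1$, then $\mathrm{L}(\gamma)=1$ for every $\gamma>0$.
   Context: Let $\boldsymbol\mu=\mu\boldsymbol 1\in\mathbb R^T$ and $\boldsymbol\Sigma=(1-\rho)\sigma^2\mathbb I+\rho\sigma^2\boldsymbol 1\boldsymbol 1^\intercal$, where $\mathbb I$ is the $T\times T$ identity matrix and $\boldsymbol 1$ the all-ones vector. $\mathcal P$ is the set of all Borel probability distributions $\mathbb P$ of a random vector $\tilde{\boldsymbol\xi}=(\tilde\xi_1,\dots,\tilde\xi_T)^\intercal$ supported on $\mathbb R^T_+$ with $\mathbb E_{\mathbb P}(\tilde{\boldsymbol\xi})=\boldsymbol\mu$ and $\mathbb E_{\mathbb P}(\tilde{\boldsymbol\xi}\tilde{\boldsymbol\xi}^\intercal)=\boldsymbol\Sigma+\boldsymbol\mu\boldsymbol\mu^\intercal$. *)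

(* Defs.v *)
From HB Require Import structures.
From mathcomp Require Import all_boot all_order all_algebra.
From mathcomp Require Import all_classical all_reals all_analysis.

Set Implicit Arguments.
Unset Strict Implicit.
Unset Printing Implicit Defensive.

Import Order.TTheory GRing.Theory Num.Theory.
Import numFieldNormedType.Exports.

Local Open Scope classical_set_scope.
Local Open Scope ring_scope.

(* Column vectors in R^T with the Borel sigma-algebra of the usual topology. *)
Notation borelcV R T := (g_sigma_algebraType (@open 'cV[R]_T)).

Definition xi (R : realType) (T : nat) (i : 'I_T) (x : borelcV R T) : R :=
  (x : 'cV[R]_T) i 0.

Definition ones (R : realType) (T : nat) : 'cV[R]_T := const_mx 1.

Definition mean_vec (R : realType) (T : nat) (mu : R) : 'cV[R]_T :=
  mu *: ones R T.

Definition cov_mx (R : realType) (T : nat) (sigma rho : R) : 'M[R]_T :=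
  ((1 - rho) * sigma ^+ 2) *: 1%:M
  + (rho * sigma ^+ 2) *: (ones R T *m (ones R T)^T).

Definition orthant (R : realType) (T : nat) : set (borelcV R T) :=
  [set x | forall i, 0 <= xi i x].

(* The random vector is the identity on R^T, so its law is P itself.  The
   orthant being closed, "supported on" it means having mass 1 there.  The
   moment conditions are equalities in \bar R with finite right-hand sides,
   hence include the integrability of the integrands. *)
Definition ambiguity_set (R : realType) (T : nat) (mu sigma rho : R) :
    set (probability (borelcV R T) R) :=
  [set P : probability (borelcV R T) R |
    [/\ P (@orthant R T) = 1%E,
        forall i : 'I_T,
          ('E_P[fun x => xi i x] = (mean_vec T mu i 0)%:E)%E
      & forall i j : 'I_T,
          ('E_P[fun x => (xi i x * xi j x)%R] =
           ((cov_mx T sigma rho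
             + mean_vec T mu *m (mean_vec T mu)^T) i j)%:E)%E]].

Definition prod_le (R : realType) (T : nat) (gamma : R) :
    set (borelcV R T) :=
  [set x | \prod_(t < T) xi t x <= gamma].

Definition Lprob (R : realType) (T : nat) (mu sigma rho gamma : R) : \bar R :=
  ereal_sup [set P (@prod_le R T gamma)
            | P in @ambiguity_set R T mu sigma rho].

(* Main.v *)
Require Import Defs.
From HB Require Import structures.
From mathcomp Require Import all_boot all_order all_algebra.
From mathcomp Require Import all_classical all_reals all_analysis.
From mathcomp Require Import measurable_realfun ring lra.

Import Order.TTheory GRing.Theory Num.Theory.
Import numFieldNormedType.Exports.

Local Open Scope classical_set_scope.
Local Open Scope ring_scope.

(* The supremum is attained: an explicit member of the ambiguity set puts all
   its mass on vectors with a zero coordinate, so the product vanishes almost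
   surely.  With the i-th unit vector e_i, i uniform in {1..T}, its atoms are
   h e_i, g (1 - e_i) with g = h / (T - 1), and 0.  Since then h e_i and
   g (1 - e_i) have the same coordinate sum h, matching mean and second moments
   forces h = (D + T c) / mu, where D = (1 - rho) sigma^2 and
   c = mu^2 + rho sigma^2.  The mass of the h e_i is nonnegative iff
   c <= (T - 2) D, which is the (non-strict) hypothesis on T, and the mass left
   for 0 is nonnegative iff 1 + (T - 1) rho >= 0. *)

Lemma finite_support_probability (d : measure_display) (X : measurableType d)
    (R : realType) (I : finType) (w : I -> R) (x : I -> X) :
  (forall i, 0 <= w i) -> \sum_i w i = 1 ->
  exists P : probability X R,
    (forall A, P A = (\sum_i w i * \1_A (x i))%:E) /\
    (forall f : X -> R, measurable_fun setT f ->
       ('E_P[f] = (\sum_i w i * f (x i))%R%:E)%E).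
Proof.
move=> w0 w1.
(* Weights with sum 1 force [I] to be nonempty, which supplies the default element of [nth]. *)
case: (pickP (fun _ : I => true)) => [i0 _|I0]; last first.
  by move: w1; rewrite big_pred0 // => /eqP; rewrite eq_sym oner_eq0.
pose e n := nth i0 (enum I) n.
pose m n : {measure set X -> \bar R} := mscale (NngNum (w0 (e n))) \d_(x (e n)).
pose M : {measure set X -> \bar R} := msum m #|I|.
have sumE (F : I -> R) : (\sum_(n < #|I|) (F (e n))%:E = (\sum_i F i)%R%:E)%E.
  by rewrite sumEFin -[in RHS]big_enum (big_nth i0) big_mkord -cardT.
have MA A : M A = (\sum_i w i * \1_A (x i))%:E.
  rewrite -[X in _ = X](sumE (fun i => w i * \1_A (x i))) /M /msum.
  by apply: eq_bigr => n _; rewrite /= /mscale /= diracE indicE EFinM.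
have M1 : M setT = 1%E.
  rewrite MA -w1; congr EFin; apply: eq_bigr => i _.
  by rewrite indicE in_setT mulr1.
have Mge0 (f : X -> R) : measurable_fun setT f -> (forall y, 0 <= f y) ->
    (\int[M]_y (f y)%:E = (\sum_i w i * f (x i))%R%:E)%E.
  move=> mf f0.
  have mEf : measurable_fun setT (EFin \o f) by exact/measurable_EFinP.
  have Ef0 y : setT y -> (0%R <= (f y)%:E)%E by rewrite lee_fin.
  rewrite ge0_integral_measure_sum // -[X in _ = X](sumE (fun i => w i * f (x i))).
  apply: eq_bigr => n _.
  by rewrite ge0_integral_mscale // integral_dirac // diracT mul1e.
have [P PM] : exists P : probability X R, P = M :> (set X -> \bar R).
  by exists (HB.pack_for (probability X R) (msum m #|I|)
    (Measure_isProbability.Build _ _ _ M M1)).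
exists P; split => [A|f mf]; first by rewrite PM.
(* A signed [f] is split into positive and negative parts; both integrals are finite sums of reals,
   so their difference is a real one. *)
rewrite unlock PM integralE (funerpos f) (funerneg f).
rewrite (Mge0 f^\+) ?(Mge0 f^\-).
- rewrite -EFinB -sumrB; congr EFin; apply: eq_bigr => i _.
  rewrite -mulrBr; congr (_ * _).
  exact: (congr1 (@^~ (x i)) (funrposBneg f)).
- exact: measurable_funrneg.
- exact: funrneg_ge0.
- exact: measurable_funrpos.
- exact: funrpos_ge0.
Qed.

(** Open intervals generate the Borel sets of the line, and their preimages under a continuous
    coordinate map are open. *)
Lemma measurable_xi (R : realType) (T : nat) (i : 'I_T) :
  measurable_fun setT (@xi R T i).
Proof.
apply: (measurability _ (RGenOpens.measurableE R)) => _ [_ [a [b ->] <-]].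
rewrite setTI; apply: sub_sigma_algebra.
move/continuousP: (@coord_continuous R T 1 i 0); apply.
exact: interval_open.
Qed.

Lemma sum_eq_indicator (R : comNzRingType) (I : finType) (j : I) (F : I -> R) :
  \sum_i (j == i)%:R * F i = F j.
Proof.
rewrite (bigD1 j) //= eqxx mul1r big1 ?addr0 // => i ij.
by rewrite eq_sym (negbTE ij) mul0r.
Qed.

(** Each family of atoms consists of the vectors u 1 + d e_i; this sum gives its contribution to the
    mean, and [sum_spikedM] the one to the second moments. *)
Lemma sum_spiked (R : comNzRingType) (I : finType) (u d : R) (j : I) :
  \sum_i (u + (j == i)%:R * d) = #|I|%:R * u + d.
Proof.
by rewrite big_split /= sumr_const sum_eq_indicator mulr_natl.
Qed.

Lemma sum_spikedM (R : comNzRingType) (I : finType) (u d : R) (j l : I) :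
  \sum_i (u + (j == i)%:R * d) * (u + (l == i)%:R * d)
    = (j == l)%:R * d ^+ 2 + (#|I|%:R * u ^+ 2 + 2 * u * d).
Proof.
transitivity (\sum_i ((u * u + (j == i)%:R * (d * u))
   + ((l == i)%:R * (d * u) + (j == i)%:R * ((l == i)%:R * d ^+ 2)))).
  by apply: eq_bigr => i _; ring.
rewrite !big_split /= sumr_const !sum_eq_indicator eq_sym -mulr_natl.
ring.
Qed.

(* a, b and e are the masses of each single atom h e_i, g (1 - e_i) and 0, the
   last one being repeated n times. *)
Lemma moment_weights_exist (R : realFieldType) (n mu D c : R) :
  2 < n -> 0 < mu -> 0 < c -> c < (n - 2) * D -> n * mu ^+ 2 <= D + n * c ->
  exists a b e h g : R,
    [/\ 0 <= a, 0 <= b, 0 <= e, 0 <= h & 0 <= g] /\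
    [/\ n * (a + b + e) = 1,
        a * h + b * ((n - 1) * g) = mu,
        a * h ^+ 2 + b * g ^+ 2 = D
      & (n - 2) * b * g ^+ 2 = c].
Proof.
move=> n2 mu0 c0 cD nmu.
have D0 : 0 < D by rewrite -(pmulr_rgt0 _ (_ : 0 < n - 2)); lra.
have S0 : 0 < D + n * c by rewrite addr_gt0 // mulr_gt0 //; lra.
pose h := (D + n * c) / mu; pose g := h / (n - 1).
have h0 : 0 < h by rewrite divr_gt0.
have n10 : 0 < n - 1 by lra.
have n20 : 0 < n - 2 by lra.
have g0 : 0 < g by rewrite divr_gt0.
(* The last equation determines b, and then the third one determines a. *)
pose a := (D - c / (n - 2)) / h ^+ 2; pose b := c / ((n - 2) * g ^+ 2).
(* Every nonzero atom has coordinate sum h, so the mean condition forces a + b = mu / h. The total n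
   (a + b) must not exceed 1 if e is to be nonnegative. *)
have ab : n * (a + b) = n * mu ^+ 2 / (D + n * c).
  by rewrite /a /b /g /h; field; rewrite !gt_eqF //; lra.
exists a, b, (n^-1 - (a + b)), h, g; split; split; rewrite ?(ltW h0) ?(ltW g0) //.
- by rewrite divr_ge0 ?sqr_ge0 // subr_ge0 ltW // ltr_pdivrMr // mulrC.
- by rewrite divr_ge0 ?(ltW c0) // mulr_ge0 ?sqr_ge0 // ltW.
- rewrite subr_ge0 -(ler_pM2l (_ : 0 < n)) ?ab; last by lra.
  by rewrite divff ?gt_eqF ?ler_pdivrMr ?mul1r //; lra.
- by field; rewrite gt_eqF //; lra.
- by rewrite /a /b /g /h; field; rewrite !gt_eqF //; lra.
- by rewrite /a /b /g; field; rewrite !gt_eqF //; lra.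
- by rewrite /b; field; rewrite !gt_eqF //; lra.
Qed.

Theorem theorem3p2 (R : realType) (T : nat) (mu sigma rho : R)
    (hT : (2 <= T)%N) (hmu : 0 < mu) (hsigma : 0 < sigma)
    (hrho_lb : - (1 / (T%:R - 1)) < rho) (hrho_ub : rho < 1)
    (hpos : 0 < mu ^+ 2 + rho * sigma ^+ 2)
    (hTlarge :
       (mu ^+ 2 + sigma ^+ 2) / ((1 - rho) * sigma ^+ 2) + 1 < T%:R) :
  forall gamma : R, 0 < gamma -> Lprob T mu sigma rho gamma = 1%E.
Proof.
move=> gamma gamma0.
set D := (1 - rho) * sigma ^+ 2 in hTlarge *.
set c := mu ^+ 2 + rho * sigma ^+ 2 in hpos.
have s0 : 0 < sigma ^+ 2 by rewrite exprn_gt0.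
have D0 : 0 < D by rewrite mulr_gt0 // subr_gt0.
have msE : mu ^+ 2 + sigma ^+ 2 = c + D by rewrite /c /D; ring.
have T1 : 1 < T%:R :> R by rewrite ltr1n.
have cD : c < (T%:R - 2) * D.
  by move: hTlarge; rewrite msE -ltrBrDr ltr_pdivrMr //; lra.
(* Since c > 0, the bound [cD] excludes T = 2. *)
have T2 : 2 < T%:R :> R.
  by rewrite -subr_gt0 -(pmulr_lgt0 _ D0) (lt_trans hpos).
(* The difference of the two sides is the eigenvalue of the covariance matrix on the all-ones
   vector. *)
have nmu : T%:R * mu ^+ 2 <= D + T%:R * c.
  have rhoT : 0 <= 1 + (T%:R - 1) * rho.
    by move: hrho_lb; rewrite -mulNr ltr_pdivrMr ?subr_gt0 //; lra.
  rewrite -subr_ge0 (_ : _ - _ = (1 + (T%:R - 1) * rho) * sigma ^+ 2).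
    by rewrite mulr_ge0 // ltW.
  by rewrite /D /c; ring.
have [a [b [e [h [g [[a0 b0 e0 h0 g0] [Emass Emean Ediag Eoff]]]]]]] :=
  moment_weights_exist _ _ _ _ _ T2 hmu hpos cD nmu.
(* The atom of index (k, i) has i-th coordinate u k + d k, the others u k. *)
pose w (p : 'I_3 * 'I_T) : R := [:: a; b; e]`_p.1.
pose u (k : 'I_3) : R := [:: 0; g; 0]`_k.
pose d (k : 'I_3) : R := [:: h; - g; 0]`_k.
pose x (p : 'I_3 * 'I_T) : borelcV R T :=
  (\col_j (u p.1 + (j == p.2)%:R * d p.1))%R : 'cV[R]_T.
have xiE p j : xi j (x p) = u p.1 + (j == p.2)%:R * d p.1 by rewrite /xi mxE.
have sumE (F : 'I_3 * 'I_T -> R) : \sum_p F p = \sum_k \sum_i F (k, i).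
  by rewrite pair_bigA; apply: eq_bigr => -[].
have sum3 (F : 'I_3 -> R) :
    \sum_k F k = F ord0 + F (lift ord0 ord0) + F (lift ord0 (lift ord0 ord0)).
  by rewrite !big_ord_recl big_ord0 addr0 addrA.
have w0 p : 0 <= w p by rewrite /w; case: p => [[[|[|[|]]]]].
have w1 : \sum_p w p = 1.
  by rewrite sumE sum3 /w /= !sumr_const card_ord -!mulrnDl -mulr_natl.
have [P [PE EE]] := finite_support_probability _ _ _ _ _ x w0 w1.
have full A : (forall p, A (x p)) -> P A = 1%E.
  move=> Ax; rewrite PE -w1; congr EFin; apply: eq_bigr => p _.
  by rewrite indicE mem_set ?mulr1.
have PA : ambiguity_set mu sigma rho P.
  split.
  - apply: full => -[k i] j; rewrite xiE /u /d.
    by case: k => [[|[|[|]]]] //= _; case: eqP => _ /=; lra.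
  - move=> j; rewrite EE; last exact: measurable_xi.
    congr EFin; rewrite sumE !mxE mulr1 -Emean.
    under eq_bigr => k _.
      under eq_bigr => i _ do rewrite xiE /=.
      rewrite -mulr_sumr sum_spiked; over.
    by rewrite sum3 /w /u /d /= card_ord; ring.
  - move=> j l; rewrite EE; last by apply: measurable_funM; exact: measurable_xi.
    congr EFin; rewrite sumE.
    under eq_bigr => k _.
      under eq_bigr => i _ do rewrite !xiE /=.
      rewrite -mulr_sumr sum_spikedM; over.
    rewrite sum3 /w /u /d /= card_ord !mxE !big_ord1 !mxE -/D.
    (* [Eoff] matches the off-diagonal entries, where only the T - 2 indices i other than j and l
       contribute; [Ediag] matches the excess of the diagonal over them. *)
    transitivity ((j == l)%:R * D + c); last by rewrite /c; ring.
    by rewrite -Eoff -Ediag; ring.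
have mprod : measurable (@prod_le R T gamma).
  rewrite -[prod_le _]setTI; apply: measurable_fun_le => //.
  by apply: measurable_prod => i _; exact: measurable_xi.
have Pprod : P (@prod_le R T gamma) = 1%E.
  apply: full => -[k i]; rewrite /prod_le /=.
  have [j xj0] : exists j, xi j (x (k, i)) = 0.
    (* The atom h e_i vanishes only away from i, so a second coordinate is picked among the first
       two; the other atoms vanish at i itself. *)
    pose i' : 'I_T := if i == Ordinal hT then Ordinal (ltnW hT) else Ordinal hT.
    have ii' : i' != i by rewrite /i'; case: ifPn => [/eqP ->|]; rewrite // eq_sym.
    exists (if k == ord0 then i' else i); rewrite xiE /=.
    case: k => [[|[|[|]]]] //= ?; rewrite /u /d /= ?eqxx ?(negbTE ii') /=; ring.
  by rewrite (bigD1 j) //= xj0 mul0r ltW.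
apply/eqP; rewrite eq_le; apply/andP; split.
- by apply: ge_ereal_sup => _ [Q _ <-]; exact: probability_le1.
- by apply: ereal_sup_ubound; exists P.
Qed.
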